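(* Let $\mathcal{X}$ be a $3$-dimensional polyhedral Banach space (that is, $\mathbb{R}^3$ with a polyhedral norm) whose closed unit ball $B_{\mathcal{X}}$ is the polyhedron, obtained by gluing two pyramids at the opposite base faces of a right prism having square base, with vertices $\pm(1,1,1)$, $\pm(-1,1,1)$, $\pm(-1,-1,1)$, $\pm(1,-1,1)$, $\pm(0,0,2)$. Then $$\eta_{dw}(\mathcal{X})=\frac{\sqrt{5}}{2}.$$
   Context: A finite-dimensional real Banach space is polyhedral if its closed unit ball has finitely many extreme points; the polyhedron with given vertices is their convex hull. $\mathcal{L}(\mathcal{X})$ is the space of bounded linear operators on $\mathcal{X}$ with the operator norm, and $S_{\mathcal{L}(\mathcal{X})}$ is its unit sphere; $\mathcal{X}^*$ is the dual; $S_{\mathcal{X}}=\{x:\|x\|=1\}$. For $x\in S_{\mathcal{X}}$ put $\mathcal{J}(x)=\{f\in\mathcal{X}^*: f(x)=1=\|f\|\}$, and $\Pi=\{(x,f): x\in S_{\mathcal{X}}, f\in\mathcal{J}(x)\}$. The Davis-Wielandt radius of $T$ is $dw(T)=\sup\left\{\sqrt{|x^*(Tx)|^2+\|Tx\|^4}:(x,x^* )\in\Pi\right\}$ and the Davis-Wielandt index of $\mathcal{X}$ is $\eta_{dw}(\mathcal{X})=\inf\{dw(T):T\in S_{\mathcal{L}(\mathcal{X})}\}$. *)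

(* Defs.v *)
From HB Require Import structures.
From mathcomp Require Import all_boot all_order all_algebra.
From mathcomp Require Import all_classical all_reals all_analysis.
Set Implicit Arguments.
Unset Strict Implicit.
Unset Printing Implicit Defensive.
Import Order.TTheory GRing.Theory Num.Theory.
Import numFieldNormedType.Exports.
Local Open Scope classical_set_scope.
Local Open Scope ring_scope.

Definition convex_hull (R : realType) (V : lmodType R) (A : set V) : set V :=
  smallest (@convex_set R V) A.

Definition extreme_points (R : realType) (V : lmodType R) (A : set V) : set V :=
  [set x | A x /\ forall (y z : V) (t : R), A y -> A z -> 0 < t < 1 ->
     x = t *: y + (1 - t) *: z -> y = x /\ z = x].

(* Meant for finite-dimensional [X]; the dimension is fixed separately. *)
Definition polyhedral (R : realType) (X : normedModType R) : Prop :=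
  finite_set (extreme_points (closed_ball (0 : X) 1)).

(* [sup] is real-valued and equals 0 on an unbounded set, so this is the
   operator norm only for continuous [T]; every use below requires that. *)
Definition op_norm (R : realType) (V W : normedModType R)
    (T : {linear V -> W}) : R :=
  sup [set `|T x| | x in closed_ball (0 : V) 1].

(* J(x); the dual of X consists of the continuous [f : {linear X -> R^o}]. *)
Definition support_functionals (R : realType) (X : normedModType R) (x : X) :
    set {linear X -> R^o} :=
  [set f : {linear X -> R^o} | [/\ continuous f, f x = 1 & op_norm f = 1]].

Definition dw_pairs (R : realType) (X : normedModType R) :
    set (X * {linear X -> R^o}) :=
  [set p | `|p.1| = 1 /\ support_functionals p.1 p.2].

Definition dw_radius (R : realType) (X : normedModType R)
    (T : {linear X -> X}) : R :=
  sup [set Num.sqrt (`|p.2 (T p.1)| ^+ 2 + `|T p.1| ^+ 4) | p in @dw_pairs R X].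

Definition op_sphere (R : realType) (X : normedModType R) :
    set {linear X -> X} :=
  [set T : {linear X -> X} | continuous T /\ op_norm T = 1].

Definition dw_index (R : realType) (X : normedModType R) : R :=
  inf [set dw_radius T | T in @op_sphere R X].

Definition vec3 (R : realType) (a b c : R) : 'rV[R]_3 :=
  \row_(j < 3) [:: a; b; c]`_j.

Definition bipyramid_vertices (R : realType) : set 'rV[R]_3 :=
  let V := [set vec3 1 1 1; vec3 (-1) 1 1; vec3 (-1) (-1) 1; vec3 1 (-1) 1;
                vec3 0 0 2] : set 'rV[R]_3 in
  V `|` [set - v | v in V].
Arguments bipyramid_vertices R : clear implicits.

(* Main.v *)
Require Import Defs.
From HB Require Import structures.
From mathcomp Require Import all_boot all_order all_algebra.
From mathcomp Require Import all_classical all_reals all_analysis.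
From mathcomp Require Import ring lra.
Import Order.TTheory GRing.Theory Num.Theory.
Import numFieldNormedType.Exports.
Local Open Scope classical_set_scope.
Local Open Scope ring_scope.
Set Implicit Arguments.
Unset Strict Implicit.
Unset Printing Implicit Defensive.

(** Writing m = max(|a|, |b|), the bipyramid is the unit ball of
    N(a, b, c) = max(m, (m + |c|) / 2): the vertical faces of the prism give m
    and the slanted faces of the two pyramids give (m + |c|) / 2
    ([convex_hull_bipyramid], [norm_bipyramid]). Dually, the functional with
    coefficients (p, q, r) has norm at most 1 exactly when it is at most 1 at
    the vertices, that is when |p| + |q| + |r| <= 1 and 2 |r| <= 1: sufficiency
    is [bipyramid_dual], necessity is used for [extremal_operator].

    Lower bound. An operator T of norm 1 attains its norm at some vertex u,
    because the norm of T is a convex function ([op_norm_attained]). If w = T u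
    has norm 1, some face functional f with f(u) = 1 satisfies |f(w)| >= 1/2:
    otherwise the faces meeting at u (and, through the triangle inequality,
    the remaining ones) would all stay below 1 at w ([vertex_support]). Hence
    the pair (u, f) contributes at least sqrt(1/4 + 1) to the Davis-Wielandt
    radius ([dw_radius_ge]).

    Upper bound. The operator T(a, b, c) = (c / 2, 0, 0) has norm 1, attained
    at the apex (0, 0, 2), and f(T v) = p c / 2 for f = (p, q, r). This is at
    most 1/2 in absolute value for every supporting pair: if |c| > 1, then
    f(v) = 1 forces |r| = 1/2, hence |p| <= 1/2, while |c| <= 2
    ([pairing_le1]). So the radius of T is at most sqrt(1/4 + 1)
    ([extremal_operator]). *)

(** * Convex hulls, linear maps and the operator norm *)

(** Spells out the convexity operator, so that the rest is plain algebra in a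
    real parameter [t]. *)
Lemma convex_setP (R : realType) (V : lmodType R) (C : set V) :
  convex_set C <->
  forall (x y : V) (t : R), 0 <= t <= 1 -> C x -> C y ->
    C (t *: x + (1 - t) *: y).
Proof.
split=> [cC x y t /andP[t0 t1] Cx Cy|cC x y t].
  by have := cC x y (Itv01 t0 t1); rewrite !inE; apply.
rewrite !inE => Cx Cy; apply: cC => //.
by apply/andP; split; [exact: ge0|exact: le1].
Qed.

Lemma convex_hull_convex (R : realType) (V : lmodType R) (A : set V)
    (x y : V) (t : R) : 0 <= t <= 1 ->
  convex_hull A x -> convex_hull A y ->
  convex_hull A (t *: x + (1 - t) *: y).
Proof.
move=> t01 hx hy C [cC AC]; apply: (convex_setP C).1 => //.
- by apply: hx.
- by apply: hy.
Qed.

(** Linear maps out of [V] can be given by formulas in the coordinates that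
    [phi] provides: compose with the inverse of [phi]. *)
Lemma linear_factor (R : realType) (U V W : lmodType R)
    (phi : {linear U -> V}) (g : U -> W) : bijective phi -> linear g ->
  exists h : {linear V -> W}, forall u, h (phi u) = g u.
Proof.
case=> psi phiK psiK gl.
have psil : linear psi := can2_linear phiK psiK.
have hl : linear (g \o psi) by move=> a x y /=; rewrite psil gl.
pose hM := GRing.isLinear.Build R V W *:%R (g \o psi) hl.
pose h : {linear V -> W} := HB.pack (g \o psi) hM.
by exists h => u /=; rewrite phiK.
Qed.

Section op_norm.
Context (R : realType) (V W : normedModType R).
Implicit Type T : {linear V -> W}.

Lemma unit_ballE : closed_ball (0 : V) 1 = [set x | `|x| <= 1].
Proof.
rewrite closed_ballE // /closed_ball_; apply/seteqP.
by split=> x /=; rewrite sub0r normrN.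
Qed.

Lemma contraction_continuous T : (forall x, `|T x| <= `|x|) -> continuous T.
Proof.
move=> T1; apply: bounded_linear_continuous; apply/linear_boundedP.
near=> r => x; apply: le_trans (T1 x) _.
rewrite ler_peMl //; near: r; exact: nbhs_pinfty_ge.
Unshelve. all: by end_near. Qed.

Lemma op_norm_eq1 T x : (forall x, `|T x| <= `|x|) -> `|x| <= 1 ->
  `|T x| = 1 -> op_norm T = 1.
Proof.
move=> T1 x1 Tx; rewrite /op_norm unit_ballE; apply/eqP; rewrite eq_le.
apply/andP; split.
  apply: ge_sup; first by exists `|T x|, x.
  by move=> _ [y /= y1 <-]; apply: le_trans (T1 y) y1.
rewrite -[leLHS]Tx; apply: ub_le_sup; last by exists x.
by exists 1 => _ [y /= y1 <-]; apply: le_trans (T1 y) y1.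
Qed.

(** The value 1 is what makes [T] bounded here: the supremum of a set of reals
    that is not bounded above is 0 by convention. *)
Lemma op_norm1_le T x : op_norm T = 1 -> `|T x| <= `|x|.
Proof.
move=> T1.
have hT : has_ubound [set `|T x| | x in closed_ball (0 : V) 1].
  apply: contrapT => hT; move: T1; rewrite /op_norm sup_out => [/eqP|].
    by rewrite eq_sym oner_eq0.
  by case.
have [->|x0] := eqVneq x 0; first by rewrite linear0 !normr0.
have xp : 0 < `|x| by rewrite normr_gt0.
have : `|T (`|x|^-1 *: x)| <= 1.
  rewrite -T1; apply: ub_le_sup => //; exists (`|x|^-1 *: x) => //.
  by rewrite unit_ballE /= normrZ normfV normr_id mulVf // gt_eqF.
by rewrite linearZ normrZ normfV normr_id ler_pdivrMl // mulr1.
Qed.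

(** The sublevel sets of the convex function [v |-> `|T (phi v)|] are convex,
    so a bound valid on [A] is valid on its hull. *)
Lemma op_norm_attained (U : lmodType R) (phi : {linear U -> V}) (A : set U) T :
  finite_set A -> closed_ball (0 : V) 1 `<=` phi @` convex_hull A ->
  0 < op_norm T -> exists2 v, A v & op_norm T <= `|T (phi v)|.
Proof.
move=> /finite_seqP[s ->] ballA Tp; apply: contrapT => noT.
(* The default value 0 is harmless because [op_norm T] is positive. *)
pose c : R := \big[Num.max/0]_(v <- s) `|T (phi v)|.
have cT : c < op_norm T.
  rewrite /c big_seq; apply: bigmax_lt => // v sv.
  by rewrite ltNge; apply/negP => vT; apply: noT; exists v.
suff : op_norm T <= c by rewrite leNgt cT.
apply: ge_sup.
  by exists `|T 0|, 0 => //; rewrite unit_ballE /= normr0.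
move=> _ [_ /ballA[v hv <-] <-]; apply: (hv [set v | `|T (phi v)| <= c]).
split=> [|w /= sw]; last first.
  exact: (le_bigmax_seq 0 w xpredT (fun v => `|T (phi v)|)).
apply/convex_setP => x y t /andP[t0 t1] /= xc yc.
rewrite linearD !linearZ linearD !linearZ; apply: le_trans (ler_normD _ _) _.
rewrite !normrZ (ger0_norm t0) [`|1 - t|]ger0_norm ?subr_ge0 //.
have t1' : 0 <= 1 - t by rewrite subr_ge0.
have := ler_wpM2l t0 xc; have := ler_wpM2l t1' yc; lra.
Qed.

End op_norm.

(** * The bipyramid norm and its dual *)

Section bipyramid.
Context (R : realType).
Implicit Types (a b c p q r : R) (u v w : 'rV[R]_3).

Lemma vec3E a b c : ((vec3 a b c 0 0 = a) * (vec3 a b c 0 1 = b) *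
  (vec3 a b c 0 2 = c))%type.
Proof. by rewrite /vec3 !mxE. Qed.

Lemma vec3K v : vec3 (v 0 0) (v 0 1) (v 0 2) = v.
Proof.
apply/rowP => j; rewrite mxE; case: j => [[|[|[|//]]] j3] /=;
  by congr (v _ _); apply: val_inj.
Qed.

Lemma vec3_comb t a b c a' b' c' :
  t *: vec3 a b c + (1 - t) *: vec3 a' b' c' =
  vec3 (t * a + (1 - t) * a') (t * b + (1 - t) * b') (t * c + (1 - t) * c').
Proof.
by apply/rowP => j; rewrite !mxE; case: j => [[|[|[|//]]] j3].
Qed.

Definition bipyramid_norm v : R :=
  let m := Num.max `|v 0 0| `|v 0 1| in Num.max m ((m + `|v 0 2|) / 2).

Lemma bipyramid_norm_le v r : (bipyramid_norm v <= r) =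
  [&& `|v 0 0| <= r, `|v 0 1| <= r, `|v 0 0| + `|v 0 2| <= 2 * r &
      `|v 0 1| + `|v 0 2| <= 2 * r].
Proof.
rewrite /bipyramid_norm ge_max ler_pdivrMr // (mulrC r) -lerBrDr !ge_max.
by rewrite !lerBrDr -andbA.
Qed.

Lemma bipyramid_norm_lt v r : (bipyramid_norm v < r) =
  [&& `|v 0 0| < r, `|v 0 1| < r, `|v 0 0| + `|v 0 2| < 2 * r &
      `|v 0 1| + `|v 0 2| < 2 * r].
Proof.
rewrite /bipyramid_norm gt_max ltr_pdivrMr // (mulrC r) -ltrBrDr !gt_max.
by rewrite !ltrBrDr -andbA.
Qed.

Lemma bipyramid_normP v :
  [/\ `|v 0 0| <= bipyramid_norm v, `|v 0 1| <= bipyramid_norm v,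
      `|v 0 0| + `|v 0 2| <= 2 * bipyramid_norm v &
      `|v 0 1| + `|v 0 2| <= 2 * bipyramid_norm v].
Proof. by apply/and4P; rewrite -bipyramid_norm_le. Qed.

Lemma bipyramid_normZ r v : 0 <= r ->
  bipyramid_norm (r *: v) = r * bipyramid_norm v.
Proof.
move=> r0; rewrite /bipyramid_norm !mxE !normrM !(ger0_norm r0).
by rewrite -maxr_pMr // -mulrDr -mulrA -maxr_pMr.
Qed.

Lemma bipyramid_norm_ge0 v : 0 <= bipyramid_norm v.
Proof. by case: (bipyramid_normP v) => h _ _ _; apply: le_trans h. Qed.

Lemma finite_bipyramid_vertices : finite_set (bipyramid_vertices R).
Proof.
rewrite /bipyramid_vertices /= finite_setU.
by split; last apply: finite_image; exact: finite_set5.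
Qed.

(** A uniform description by signs lets one argument treat all the corners of
    the prism, and another both apexes. *)
Lemma bipyramid_verticesE v : bipyramid_vertices R v <->
  (exists s1 s2 s3 : bool, v = vec3 ((-1) ^+ s1) ((-1) ^+ s2) ((-1) ^+ s3)) \/
  (exists s : bool, v = vec3 0 0 ((-1) ^+ s * 2)).
Proof.
have N a b c : - vec3 a b c = vec3 (- a) (- b) (- c).
  by apply/rowP => j; rewrite !mxE; case: j => [[|[|[|//]]] j3].
split.
  case=> [|[w + <-]]; (move=> [[[[->|->]|->]|->]|->]; rewrite ?N ?opprK ?oppr0);
    do ?[by right; exists false; rewrite mul1r
        |by right; exists true; rewrite mulN1r
        |by left; exists false, false, false|by left; exists true, false, false
        |by left; exists true, true, false|by left; exists false, true, false
        |by left; exists false, false, true|by left; exists true, false, true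
        |by left; exists true, true, true|by left; exists false, true, true].
case=> [[s1 [s2 [s3 ->]]]|[s ->]].
  case: s3; last first.
    by left; case: s1; case: s2; rewrite /= ?expr0 ?expr1; tauto.
  right; exists (vec3 (- (-1) ^+ s1) (- (-1) ^+ s2) 1).
    by case: s1; case: s2; rewrite /= ?expr0 ?expr1 ?opprK; tauto.
  by rewrite N !opprK.
case: s; rewrite /= ?expr0 ?expr1 ?mul1r ?mulN1r.
  by right; exists (vec3 0 0 2); [right|rewrite N !oppr0].
by left; right.
Qed.

(** The inequalities hold at the vertices and are convex, which gives one
    inclusion. Conversely a point of the cube [|a|, |b|, |c| <= 1] is reached
    from the corners one coordinate at a time, and a point above or below the
    cube lies on a segment from an apex to a horizontal face of the cube. *)
Lemma convex_hull_bipyramid :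
  convex_hull (bipyramid_vertices R) = [set v | bipyramid_norm v <= 1].
Proof.
apply/seteqP; split=> v.
  apply; split; last first.
    move=> w /bipyramid_verticesE[[s1 [s2 [s3 ->]]]|[s ->]] /=;
    rewrite bipyramid_norm_le !vec3E ?normrM ?normr_sign ?normr0 ?mul1r;
    rewrite ?normr_nat; apply/and4P; split; lra.
  apply/convex_setP => x y t /andP[t0 t1] /=; rewrite !bipyramid_norm_le.
  have t1' : 0 <= 1 - t by rewrite subr_ge0.
  have tri i : `|(t *: x + (1 - t) *: y) 0 i| <=
      t * `|x 0 i| + (1 - t) * `|y 0 i|.
    rewrite !mxE (le_trans (ler_normD _ _)) // !normrM.
    by rewrite (ger0_norm t0) (ger0_norm t1').
  move=> /and4P[x1 x2 x3 x4] /and4P[y1 y2 y3 y4].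
  have [[T0 T1] T2] := (tri 0, tri 1, tri 2).
  apply/and4P; split; nra.
move: (vec3K v) => /= <-; rewrite /= bipyramid_norm_le !vec3E.
move: (v 0 0) (v 0 1) (v 0 2) => {v} a b c /and4P[a1 b1 ac bc].
set H := convex_hull _.
have vert v : bipyramid_vertices R v -> H v by move=> ? C [_]; apply.
have comb (t x y z a' b' c' a'' b'' c'' : R) : H (vec3 a' b' c') ->
    H (vec3 a'' b'' c'') -> 0 <= t <= 1 -> x = t * a' + (1 - t) * a'' ->
    y = t * b' + (1 - t) * b'' -> z = t * c' + (1 - t) * c'' ->
    H (vec3 x y z).
  move=> H' H'' t01 -> -> ->; rewrite -vec3_comb; exact: convex_hull_convex.
have half (x : R) : `|x| <= 1 -> 0 <= (1 + x) / 2 <= 1.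
  by rewrite ler_norml => /andP[? ?]; apply/andP; split; lra.
(* The two horizontal faces of the cube, filled from their edges. *)
have square (x y : R) (s : bool) : `|x| <= 1 -> `|y| <= 1 ->
    H (vec3 x y ((-1) ^+ s)).
  move=> x1 y1.
  have edge (s' : bool) : H (vec3 x ((-1) ^+ s') ((-1) ^+ s)).
    have corner (s'' : bool) : H (vec3 ((-1) ^+ s'') ((-1) ^+ s') ((-1) ^+ s)).
      by apply: vert; apply: (bipyramid_verticesE _).2; left; exists s'', s', s.
    apply: (comb _ _ _ _ _ _ _ _ _ _ (corner false) (corner true) (half x x1));
      by rewrite ?expr0 ?expr1; field.
  apply: (comb _ _ _ _ _ _ _ _ _ _ (edge false) (edge true) (half y y1));
    by rewrite ?expr0 ?expr1; field.
have [c1|c1] := leP `|c| 1.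
  apply: (comb _ _ _ _ _ _ _ _ _ _ (square a b false _ _)
    (square a b true _ _) (half c c1)) => //;
    by rewrite ?expr0 ?expr1; field.
have [s [k [k1 cE]]] : exists (s : bool) (k : R), 1 < k /\ c = (-1) ^+ s * k.
  exists (c < 0), `|c|; split=> //.
  by case: ltrP => c0; rewrite ?expr0 ?expr1 ?(ger0_norm c0) ?(ltr0_norm c0)
    ?mul1r ?mulN1r ?opprK.
have ck : `|c| = k.
  by rewrite cE normrM normr_sign mul1r gtr0_norm // (lt_trans ltr01).
have apex : H (vec3 0 0 ((-1) ^+ s * 2)).
  by apply: vert; apply: (bipyramid_verticesE _).2; right; exists s.
rewrite ck in ac bc.
have [k2|k2] := eqVneq k 2.
  have a0 : a = 0 by apply/eqP; rewrite -normr_le0; lra.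
  have b0 : b = 0 by apply/eqP; rewrite -normr_le0; lra.
  by rewrite a0 b0 cE k2.
have k2' : 0 < 2 - k.
  by rewrite subr_gt0 lt_neqAle k2 /=; have := normr_ge0 a; lra.
have shrink (x : R) : `|x| + k <= 2 * 1 -> `|x / (2 - k)| <= 1.
  by move=> xk; rewrite normrM normfV (gtr0_norm k2') ler_pdivrMr //; lra.
(* The weights are forced by the last coordinate: with [k = `|c|],
   [k = (2 - k) * 1 + (k - 1) * 2]. *)
apply: (comb (2 - k) _ _ _ _ _ _ _ _ _
  (square _ _ s (shrink a ac) (shrink b bc)) apex).
- by apply/andP; split; lra.
- by field; rewrite gt_eqF.
- by field; rewrite gt_eqF.
- by rewrite cE; ring.
Qed.

(** With m = max(|a|, |b|) and n = N(v), the pairing is at most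
    (1 - |r|) m + |r| |c| = (1 - 2 |r|) m + |r| (m + |c|), and m <= n,
    m + |c| <= 2 n. *)
Lemma bipyramid_dual p q r v : `|p| + `|q| + `|r| <= 1 -> 2 * `|r| <= 1 ->
  `|p * v 0 0 + q * v 0 1 + r * v 0 2| <= bipyramid_norm v.
Proof.
move=> pqr r2; have [v0 v1 v02 v12] := bipyramid_normP v.
move: (bipyramid_norm v) (bipyramid_norm_ge0 v) v0 v1 v02 v12 => n n0.
move: (v 0 0) (v 0 1) (v 0 2) => a b c an bn acn bcn.
pose m := Num.max `|a| `|b|.
have mn : m <= n by rewrite ge_max an.
have mcn : m + `|c| <= 2 * n.
  by rewrite -lerBrDr ge_max !lerBrDr acn.
have am : `|a| <= m by rewrite le_max lexx.
have bm : `|b| <= m by rewrite le_max lexx orbT.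
have m0 : 0 <= m by apply: le_trans am.
apply: (@le_trans _ _ (`|p| * m + `|q| * m + `|r| * `|c|)).
  rewrite (le_trans (ler_normD _ _)) // normrM lerD2r.
  rewrite (le_trans (ler_normD _ _)) // !normrM.
  by rewrite lerD // ler_wpM2l.
have r0 := normr_ge0 r.
have h1 : (`|p| + `|q|) * m <= (1 - `|r|) * m by apply: ler_wpM2r => //; lra.
have h2 : (1 - 2 * `|r|) * m <= (1 - 2 * `|r|) * n.
  by apply: ler_wpM2l => //; lra.
have h3 := ler_wpM2l r0 mcn.
nra.
Qed.

(** Candidates for (p, q, r) are the four faces at [u]. For a corner with
    signs (s1, s2, s3) these are (s1, 0, 0), (0, s2, 0), (s1/2, 0, s3/2) and
    (0, s2/2, s3/2); if all were below 1/2 at w = (a, b, c), then |a| < 1/2 and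
    |s1 a + s3 c| < 1, whence |a| + |c| < 2, and likewise for b. For an apex of
    sign s they are (±1/2, 0, s/2) and (0, ±1/2, s/2), and the same assumption
    gives |a| + |c| < 1 and |b| + |c| < 1. Both times [w] has norm below 1. *)
Lemma vertex_support u w : bipyramid_vertices R u -> bipyramid_norm w = 1 ->
  exists p q r, [/\ `|p| + `|q| + `|r| <= 1, 2 * `|r| <= 1,
    p * u 0 0 + q * u 0 1 + r * u 0 2 = 1 &
    2^-1 <= `|p * w 0 0 + q * w 0 1 + r * w 0 2|].
Proof.
move=> uV w1; apply: contrapT => nex.
have small p q r : `|p| + `|q| + `|r| <= 1 -> 2 * `|r| <= 1 ->
    p * u 0 0 + q * u 0 1 + r * u 0 2 = 1 ->
    `|p * w 0 0 + q * w 0 1 + r * w 0 2| < 2^-1.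
  move=> h1 h2 h3; rewrite ltNge; apply/negP => h4.
  by apply: nex; exists p, q, r.
suff : bipyramid_norm w < 1 by rewrite w1 ltxx.
have n0 : `|0 : R| = 0 := normr0 R.
have half_norm : `|2^-1 : R| = 2^-1 by rewrite normfV normr_nat.
have sqr_sign (s : bool) : (-1) ^+ s * (-1) ^+ s = 1 :> R.
  by rewrite -signr_addb addbb.
rewrite bipyramid_norm_lt.
move/bipyramid_verticesE: uV small => [[s1 [s2 [s3 ->]]]|[s ->]];
  rewrite !vec3E {nex w1}; move: (w 0 0) (w 0 1) (w 0 2) => a b c small.
- have sum_bound (x y : R) : `|x| < 2^-1 -> `|x / 2 + y / 2| < 2^-1 ->
      `|x| + `|y| < 2.
    move=> x2 xy; have yE : y = 2 * (x / 2 + y / 2) - x by field.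
    have : `|y| <= 2 * `|x / 2 + y / 2| + `|x|.
      by rewrite {1}yE (le_trans (ler_normB _ _)) // normrM normr_nat.
    lra.
  have ha : `|a| < 2^-1.
    have := small ((-1) ^+ s1) 0 0; rewrite !mul0r !addr0 normrM normr_sign.
    by rewrite mul1r n0 sqr_sign; apply=> //; lra.
  have hb : `|b| < 2^-1.
    have := small 0 ((-1) ^+ s2) 0; rewrite !mul0r !addr0 !add0r normrM.
    by rewrite normr_sign mul1r n0 sqr_sign; apply=> //; lra.
  have hac : `|a| + `|c| < 2.
    rewrite -(normrMsign s1 a) -(normrMsign s3 c); apply: sum_bound.
      by rewrite normrMsign.
    have := small ((-1) ^+ s1 / 2) 0 ((-1) ^+ s3 / 2).
    rewrite !mul0r !addr0 !normrM !normr_sign n0 half_norm.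
    by rewrite ![_ / 2 * _]mulrAC !sqr_sign; apply; lra.
  have hbc : `|b| + `|c| < 2.
    rewrite -(normrMsign s2 b) -(normrMsign s3 c); apply: sum_bound.
      by rewrite normrMsign.
    have := small 0 ((-1) ^+ s2 / 2) ((-1) ^+ s3 / 2).
    rewrite !mul0r !add0r !normrM !normr_sign n0 half_norm.
    by rewrite ![_ / 2 * _]mulrAC !sqr_sign; apply; lra.
  by apply/and4P; split; lra.
- have sum_bound (x y : R) : (forall e : bool,
      `|(-1) ^+ e / 2 * x + y / 2| < 2^-1) -> `|x| + `|y| < 1.
    move=> xy; have := xy false; have := xy true.
    rewrite expr0 expr1 !ltr_norml => /andP[? ?] /andP[? ?].
    by case: (ger0P x) => ?; case: (ger0P y) => ?; lra.
  have hac : `|a| + `|c| < 1.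
    rewrite -(normrMsign s c); apply: sum_bound => e.
    have := small ((-1) ^+ e / 2) 0 ((-1) ^+ s / 2).
    rewrite !mul0r !mulr0 !addr0 !add0r !normrM !normr_sign n0 half_norm.
    rewrite ![(-1) ^+ s / 2 * _]mulrAC !mulrA sqr_sign; apply; lra.
  have hbc : `|b| + `|c| < 1.
    rewrite -(normrMsign s c); apply: sum_bound => e.
    have := small 0 ((-1) ^+ e / 2) ((-1) ^+ s / 2).
    rewrite !mul0r !mulr0 !addr0 !add0r !normrM !normr_sign n0 half_norm.
    rewrite ![(-1) ^+ s / 2 * _]mulrAC !mulrA sqr_sign; apply; lra.
  have := normr_ge0 c; have := normr_ge0 a; have := normr_ge0 b => ? ? ?.
  by apply/and4P; split; lra.
Qed.

(** Only |c| > 1 needs an argument. Then |a|, |b| <= 2 - |c| and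
    |p| + |q| <= 1 - |r| turn the equation into
    1 <= (1 - |r|) (2 - |c|) + |r| |c|, that is (|c| - 1) (2 |r| - 1) >= 0. *)
Lemma pairing_le1 p q r v : `|p| + `|q| + `|r| <= 1 -> 2 * `|r| <= 1 ->
  bipyramid_norm v = 1 -> p * v 0 0 + q * v 0 1 + r * v 0 2 = 1 ->
  `|p * v 0 2| <= 1.
Proof.
move=> pqr r2 v1; have [] := bipyramid_normP v; rewrite {}v1.
move: (v 0 0) (v 0 1) (v 0 2) => a b c a1 b1 ac bc fv.
rewrite normrM.
have p0 := normr_ge0 p; have q0 := normr_ge0 q; have r0 := normr_ge0 r.
have [c1|c1] := leP `|c| 1.
  by rewrite mulr_ile1 //; lra.
have fv' : 1 <= (1 - `|r|) * (2 - `|c|) + `|r| * `|c|.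
  apply: (@le_trans _ _ (`|p| * `|a| + `|q| * `|b| + `|r| * `|c|)).
    rewrite -!normrM -[leLHS]fv (le_trans (ler_norm _)) //.
    by rewrite (le_trans (ler_normD _ _)) // lerD2r ler_normD.
  rewrite lerD2r; have h0 := normr_ge0 a.
  have h1 : `|p| * `|a| <= `|p| * (2 - `|c|) by apply: ler_wpM2l => //; lra.
  have h2 : `|q| * `|b| <= `|q| * (2 - `|c|) by apply: ler_wpM2l => //; lra.
  have h3 : (`|p| + `|q|) * (2 - `|c|) <= (1 - `|r|) * (2 - `|c|).
    by apply: ler_wpM2r => //; lra.
  lra.
have rE : 1 / 2 <= `|r|.
  have : 0 <= (`|c| - 1) * (2 * `|r| - 1) by lra.
  by rewrite pmulr_rge0 ?subr_gt0 //; lra.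
have h0 := normr_ge0 a.
have : `|p| * `|c| <= 2^-1 * 2 by apply: ler_pM => //; lra.
lra.
Qed.

End bipyramid.

(** * The Davis-Wielandt index *)

Section polyhedral_space.
Context (R : realType) (X : normedModType R) (phi : {linear 'rV[R]_3 -> X}).
Context (phi_bij : bijective phi).
Context (ball_eq :
  closed_ball (0 : X) 1 = phi @` convex_hull (bipyramid_vertices R)).
Implicit Types (p q r : R) (v : 'rV[R]_3) (T : {linear X -> X}).

(** Two positively homogeneous functions with the same unit ball coincide. *)
Lemma norm_bipyramid v : `|phi v| = bipyramid_norm v.
Proof.
have phi_inj := bij_inj phi_bij.
have ball1 w : (`|phi w| <= 1) = (bipyramid_norm w <= 1).
  move: ball_eq; rewrite unit_ballE convex_hull_bipyramid => /seteqP[le ge].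
  apply/idP/idP => [/le[u u1 /phi_inj <- //]|w1].
  by apply: ge; exists w.
have ball w r : 0 < r -> (`|phi w| <= r) = (bipyramid_norm w <= r).
  move=> r0; have := ball1 (r^-1 *: w).
  have ri : 0 <= r^-1 by rewrite invr_ge0 ltW.
  rewrite linearZ normrZ ger0_norm // bipyramid_normZ //.
  by rewrite !ler_pdivrMl // mulr1.
apply/eqP; rewrite eq_le; apply/andP; split; apply/ler_addgt0Pr => e e0.
  by rewrite ball ?lerDl ?ltW // ltr_wpDl // bipyramid_norm_ge0.
by rewrite -ball ?lerDl ?ltW // ltr_wpDl.
Qed.

Lemma coord_functional p q r : exists f : {linear X -> R^o},
  forall v, f (phi v) = p * v 0 0 + q * v 0 1 + r * v 0 2.
Proof.
pose g (v : 'rV[R]_3) : R^o := p * v 0 0 + q * v 0 1 + r * v 0 2.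
have gl : linear g by move=> k u v; rewrite /g !mxE /GRing.scale /=; ring.
by have [f fE] := linear_factor phi_bij gl; exists f.
Qed.

Lemma support_functional p q r v : `|p| + `|q| + `|r| <= 1 -> 2 * `|r| <= 1 ->
  p * v 0 0 + q * v 0 1 + r * v 0 2 = 1 -> bipyramid_norm v <= 1 ->
  exists2 f : {linear X -> R^o}, dw_pairs (phi v, f) &
    forall w, f (phi w) = p * w 0 0 + q * w 0 1 + r * w 0 2.
Proof.
move=> pqr r2 fv v1; have [f fE] := coord_functional p q r; exists f => //.
have f1 x : `|f x| <= `|x|.
  have [psi _ psiK] := phi_bij.
  by rewrite -(psiK x) fE norm_bipyramid; apply: bipyramid_dual.
have fv1 : f (phi v) = 1 by rewrite fE.
have nv : `|phi v| = 1.
  apply/eqP; rewrite eq_le norm_bipyramid v1 -norm_bipyramid /=.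
  by have := f1 (phi v); rewrite fv1 normr1.
split=> //; split=> //; first exact: contraction_continuous.
by apply: (@op_norm_eq1 _ _ _ _ (phi v)) => //; rewrite ?nv // fv1 normr1.
Qed.

(** Needed because the supremum defining the radius only dominates its values
    when they are bounded. *)
Lemma dw_values_ubound T : op_norm T = 1 ->
  has_ubound [set Num.sqrt (`|p.2 (T p.1)| ^+ 2 + `|T p.1| ^+ 4)
             | p in @dw_pairs R X].
Proof.
move=> T1; exists (Num.sqrt 2) => _ [[x f] [/= x1 [_ _ f1]] <-].
have Tx : `|T x| <= 1 by rewrite -x1; apply: op_norm1_le.
have fT : `|f (T x)| <= 1 by apply: le_trans (op_norm1_le _ f1) Tx.
rewrite ler_sqrt //; have := exprn_ile1 2 (normr_ge0 _) fT.
have := exprn_ile1 4 (normr_ge0 _) Tx; lra.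
Qed.

Lemma sqrt5_half : Num.sqrt 5 / 2 = Num.sqrt (5 / 4) :> R.
Proof.
rewrite sqrtrM // sqrtrV //; congr (_ / _).
by rewrite (_ : 4 = 2 ^+ 2) ?sqrtr_sqr ?ger0_norm //; ring.
Qed.

Lemma dw_radius_ge T : op_norm T = 1 -> Num.sqrt 5 / 2 <= dw_radius T.
Proof.
move=> T1.
have [u uV Tu] : exists2 u, bipyramid_vertices R u & 1 <= `|T (phi u)|.
  rewrite -T1; apply: op_norm_attained; rewrite ?ball_eq ?T1 //.
  exact: finite_bipyramid_vertices.
have u1 : bipyramid_norm u <= 1.
  have : convex_hull (bipyramid_vertices R) u by move=> C [_]; apply.
  by rewrite convex_hull_bipyramid.
have Tu1 : `|T (phi u)| = 1.
  apply/eqP; rewrite eq_le Tu andbT (le_trans (op_norm1_le _ T1)) //.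
  by rewrite norm_bipyramid.
have [psi _ psiK] := phi_bij.
have w1 : bipyramid_norm (psi (T (phi u))) = 1.
  by rewrite -norm_bipyramid psiK.
have [p [q [r [pqr r2 fu fw]]]] := vertex_support uV w1.
have [f uf fE] := support_functional pqr r2 fu u1.
apply: le_trans (ub_le_sup (dw_values_ubound T1) (ex_intro2 _ _ _ uf erefl)).
rewrite /= Tu1 sqrt5_half ler_sqrt; last first.
  by rewrite addr_ge0 // exprn_ge0.
move: fw; rewrite -fE psiK => fw.
rewrite expr1n -lerBlDr expr2; have := ler_pM _ _ fw fw; lra.
Qed.

Lemma extremal_operator : exists2 T : {linear X -> X}, op_sphere T &
  dw_radius T <= Num.sqrt 5 / 2.
Proof.
pose g v : X := (v 0 2 / 2) *: phi (vec3 1 0 0).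
have gl : linear g.
  by move=> k u v; rewrite /g !mxE mulrDl scalerDl scalerA mulrA.
have [T TE] := linear_factor phi_bij gl.
have [psi _ psiK] := phi_bij.
have nE1 : `|phi (vec3 1 0 0)| = 1.
  rewrite norm_bipyramid /bipyramid_norm !vec3E normr0 normr1.
  by rewrite max_l ?max_l //; lra.
have nT v : `|T (phi v)| = `|v 0 2| / 2.
  by rewrite TE normrZ nE1 mulr1 normrM normfV normr_nat.
have T1 x : `|T x| <= `|x|.
  rewrite -(psiK x) nT norm_bipyramid.
  have [a _ b _] := bipyramid_normP (psi x).
  have := normr_ge0 ((psi x) 0 0); lra.
have nT1 : op_norm T = 1.
  apply: (@op_norm_eq1 _ _ _ _ (phi (vec3 0 0 2))) => //.
    rewrite norm_bipyramid bipyramid_norm_le !vec3E normr0 normr_nat.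
    by apply/and4P; split; lra.
  by rewrite nT vec3E normr_nat; lra.
exists T; first by split=> //; exact: contraction_continuous.
apply: ge_sup.
  have [||||f pf _] := @support_functional 1 0 0 (vec3 1 0 0).
  - by rewrite normr1 normr0; lra.
  - by rewrite normr0; lra.
  - by rewrite !vec3E; lra.
  - by rewrite -norm_bipyramid nE1.
  by eexists; exists (phi (vec3 1 0 0), f).
move=> _ [[x f] [/= x1 [_ fx f1]] <-].
have {f1} f1 y : `|f y| <= `|y| by apply: op_norm1_le.
have phi3 a b c : phi (vec3 a b c) =
    a *: phi (vec3 1 0 0) + b *: phi (vec3 0 1 0) + c *: phi (vec3 0 0 1).
  rewrite -!linearZ -!linearD; congr (phi _); apply/rowP => j; rewrite !mxE.
  by case: j => [[|[|[|//]]] j3] /=; ring.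
pose p : R := f (phi (vec3 1 0 0)); pose q : R := f (phi (vec3 0 1 0)).
pose r : R := f (phi (vec3 0 0 1)).
have fE a b c : f (phi (vec3 a b c)) = p * a + q * b + r * c.
  by rewrite phi3 !linearD !linearZ (mulrC p) (mulrC q) (mulrC r).
have fvec a b c : bipyramid_norm (vec3 a b c) <= 1 ->
    `|p * a + q * b + r * c| <= 1.
  by rewrite -norm_bipyramid -fE; apply: le_trans (f1 _).
have r2 : 2 * `|r| <= 1.
  have := fvec 0 0 2; rewrite !mulr0 !add0r normrM normr_nat mulrC; apply.
  rewrite bipyramid_norm_le !vec3E normr0 normr_nat.
  by apply/and4P; split; lra.
(* Evaluate [f] at the corner whose signs are those of [p], [q], [r]. *)
have pqr : `|p| + `|q| + `|r| <= 1.
  have := fvec ((-1) ^+ (p < 0)%R) ((-1) ^+ (q < 0)%R) ((-1) ^+ (r < 0)%R).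
  rewrite ![_ * (-1) ^+ _]mulrC -!normrEsign => h.
  apply: le_trans (ler_norm _) (h _).
  by rewrite bipyramid_norm_le !vec3E !normr_sign; apply/and4P; split; lra.
move: x1 fx; rewrite -(psiK x); set v := psi x.
rewrite norm_bipyramid -{2}(vec3K v) fE => v1 fv.
have Tv : `|T (phi v)| <= 1 by rewrite (le_trans (T1 _)) // norm_bipyramid v1.
have fTv : `|f (T (phi v))| <= 1 / 2.
  have -> : f (T (phi v)) = p * v 0 2 / 2.
    by rewrite TE linearZ -mulrA; exact: mulrC.
  have := pairing_le1 pqr r2 v1 fv.
  by rewrite [`|_ / 2|]normrM normfV normr_nat; lra.
rewrite sqrt5_half ler_sqrt //.
have := ler_pM (normr_ge0 _) (normr_ge0 _) fTv fTv; rewrite -expr2.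
have := exprn_ile1 4 (normr_ge0 _) Tv; lra.
Qed.

End polyhedral_space.

Unset Implicit Arguments.
Set Strict Implicit.

(* [phi] is the linear identification of R^3 with the underlying space of X. *)
Theorem theorem3p5 (R : realType) (X : completeNormedModType R)
    (phi : {linear 'rV[R]_3 -> X}) (phi_bij : bijective phi)
    (X_polyhedral : polyhedral X)
    (ball_eq : closed_ball (0 : X) 1 =
               phi @` convex_hull (bipyramid_vertices R)) :
  dw_index X = Num.sqrt 5 / 2.
Proof.
have [T TS Tle] := extremal_operator phi_bij ball_eq.
have lb : lbound [set dw_radius T | T in @op_sphere R X] (Num.sqrt 5 / 2).
  by move=> _ [S [_ S1] <-]; apply: (dw_radius_ge phi_bij ball_eq).
apply/eqP; rewrite eq_le; apply/andP; split.
  apply: le_trans Tle; apply: ge_inf; last by exists T.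
  by exists (Num.sqrt 5 / 2).
by apply: lb_le_inf => //; exists (dw_radius T), T.
Qed.
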